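(* Let $K$ be an arbitrary field of characteristic $p>0$. Then each holonomic $\mathcal D(P_n)$-module $M$ has finite length, and its length does not exceed its ''multiplicity'': if $M=\mathcal D(P_n)M_0$ with $\dim_KM_0<\infty$ and $l(M)$ is a real number with $\dim_K(F_iM_0)\le l(M)i^n+o(i^n)$ for $i\gg0$, then the length of $M$ is $\le n!\,l(M)$.
   Context: $P_n=K[x_1,\dots,x_n]$, $n\ge1$; $\mathcal D(P_n)$ is the ring of $K$-linear differential operators on $P_n$; modules are left modules. For $j\ge0$, $\partial_i^{[j]}=\frac{\partial_i^j}{j!}$ is the operator $x^\alpha\mapsto\binom{\alpha_i}{j}x^{\alpha-je_i}$ (zero if $j>\alpha_i$), $\partial^{[\beta]}=\prod_i\partial_i^{[\beta_i]}$. $\mathcal D(P_n)=\bigoplus_{\alpha,\beta\in\mathbb N^n}Kx^\alpha\partial^{[\beta]}$; canonical filtration $F_i=\bigoplus_{|\alpha|+|\beta|\le i}Kx^\alpha\partial^{[\beta]}$. A nonzero finitely generated module $M=\mathcal D(P_n)M_0$ ($\dim_KM_0<\infty$) is holonomic if there is a polynomial $q\in\mathbb Q[t]$ of degree $n$ with $\dim_K(F_iM_0)\le q(i)$ for $i\gg0$ (independent of $M_0$). *)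

(* Defs.v *)
From HB Require Import structures.
From mathcomp Require Import all_boot all_order all_algebra.
From mathcomp Require Import boolp classical_sets functions topology.
From mathcomp Require Import ssrcomplements mpoly.

Set Implicit Arguments.
Unset Strict Implicit.
Unset Printing Implicit Defensive.

Import Order.TTheory GRing.Theory Num.Theory.

Local Open Scope classical_set_scope.
Local Open Scope ring_scope.

Section LinearAlgebra.
Context (K : fieldType) (V : lmodType K).

Definition kspan (A : set V) : set V :=
  [set v | exists (d : nat) (s : 'I_d -> V) (c : 'I_d -> K),
     (forall i, A (s i)) /\ v = \sum_(i < d) c i *: s i].

Definition lin_indep (d : nat) (s : 'I_d -> V) : Prop :=
  forall c : 'I_d -> K, \sum_(i < d) c i *: s i = 0 -> forall i, c i = 0.

Definition has_dim (S : set V) (d : nat) : Prop :=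
  exists s : 'I_d -> V, lin_indep s /\ S = kspan (range s).

Definition fin_dim_subspace (S : set V) : Prop := exists d, has_dim S d.

(* Junk value 0 when [S] is not a finite-dimensional subspace. *)
Definition kdim (S : set V) : nat := xget 0%N [set d | has_dim S d].

Lemma kspan_range (d : nat) (s : 'I_d -> V) (v : V) :
  kspan (range s) v <-> exists c : 'I_d -> K, v = \sum_(i < d) c i *: s i.
Proof.
split=> [[e [t [c [ts ->]]]]|[c ->]]; last first.
  by exists d, s, c; split=> // i; exists i.
have /choice[f fE] i : exists j, t i = s j by have [j _ <-] := ts i; exists j.
exists (fun j => \sum_(i < e | f i == j) c i).
under [RHS]eq_bigr do rewrite scaler_suml.
rewrite (exchange_big_dep predT) //=; apply: eq_bigr => i _.
by rewrite (big_pred1 (f i)) ?fE // => j; rewrite eq_sym.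
Qed.

Lemma has_dim_leq (S : set V) (d e : nat) :
  has_dim S d -> has_dim S e -> (d <= e)%N.
Proof.
move=> [s [s_free Ss]] [t [t_free St]].
have /choice[a aE] i : exists c : 'I_e -> K, s i = \sum_(j < e) c j *: t j.
  apply/kspan_range; rewrite -St Ss; apply/kspan_range.
  exists (fun j => (j == i)%:R).
  rewrite (bigD1 i) //= eqxx scale1r big1 ?addr0 // => j /negPf ->.
  by rewrite scale0r.
have /choice[b bE] j : exists c : 'I_d -> K, t j = \sum_(i < d) c i *: s i.
  apply/kspan_range; rewrite -Ss St; apply/kspan_range.
  exists (fun i => (i == j)%:R).
  rewrite (bigD1 j) //= eqxx scale1r big1 ?addr0 // => i /negPf ->.
  by rewrite scale0r.
apply: (@mulmx1_min _ _ _ (\matrix_(i, j) a i j) (\matrix_(j, i) b j i)).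
apply/matrixP => i k; rewrite !mxE; apply/eqP; rewrite -subr_eq0; apply/eqP.
under eq_bigr do rewrite !mxE.
move: k; apply: s_free.
under eq_bigr do rewrite scalerBl scaler_suml.
rewrite sumrB exchange_big /= [X in _ - X](bigD1 i) //= eqxx scale1r.
rewrite [X in _ - (_ + X)]big1 ?addr0; last first.
  by move=> j; rewrite eq_sym => /negPf ->; rewrite scale0r.
rewrite [X in _ - X]aE; apply/eqP; rewrite subr_eq0; apply/eqP.
apply: eq_bigr => j _; rewrite bE scaler_sumr.
by apply: eq_bigr => k _; rewrite scalerA.
Qed.

Lemma kdimE (S : set V) (d : nat) : has_dim S d -> kdim S = d.
Proof.
move=> Sd; apply: xget_unique => // e Se.
by apply/eqP; rewrite eqn_leq !(@has_dim_leq S).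
Qed.

End LinearAlgebra.

Section DiffOp.
Context (K : fieldType) (n : nat).
Local Notation P := {mpoly K[n]}.

Definition commut (f : P -> P) (r : P) : P -> P := fun p => f (r * p) - r * f p.

(* Grothendieck's recursive definition, for not necessarily linear [f];
   linearity is required separately in [is_diffop]. *)
Fixpoint order_le (k : nat) (f : P -> P) : Prop :=
  match k with
  | 0 => forall r, commut f r = 0
  | k.+1 => forall r, order_le k (commut f r)
  end.

Definition is_diffop (f : P -> P) : Prop := linear f /\ exists k, order_le k f.

Definition diffop_pred : {pred P -> P} := fun f => `[< is_diffop f >].

Lemma linear_fun0 (f : P -> P) : linear f -> f 0 = 0.
Proof. by move=> /(_ (-1) 0 0); rewrite !scaleN1r !addNr. Qed.

Lemma commutD f g r : commut (f + g) r = commut f r + commut g r.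
Proof.
apply/funext => p; rewrite /commut [(f + g) _]/(f _ + g _).
by rewrite [(f + g) p]/(f p + g p) mulrDr opprD addrACA.
Qed.

Lemma commutZ a f r : commut (a *: f) r = a *: commut f r.
Proof.
apply/funext => p; rewrite /commut [(a *: f) _]/(a *: f _).
by rewrite [(a *: f) p]/(a *: f p) [RHS]scalerBr scalerAr.
Qed.

Lemma commut0 r : commut 0 r = 0.
Proof. by apply/funext => p; rewrite /commut mulr0 subrr. Qed.

Lemma order_le0f k : order_le k 0.
Proof. by elim: k => [|k IH] r /=; rewrite commut0. Qed.

Lemma order_leD k f g : order_le k f -> order_le k g -> order_le k (f + g).
Proof.
elim: k f g => [|k IH] f g fk gk r; rewrite commutD; last exact: IH.
by rewrite fk gk addr0.
Qed.

Lemma order_leZ k a f : order_le k f -> order_le k (a *: f).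
Proof.
elim: k f => [|k IH] f fk r; rewrite commutZ; last exact: IH.
by rewrite fk scaler0.
Qed.

Lemma order_leS k f : order_le k f -> order_le k.+1 f.
Proof.
elim: k f => [|k IH] f fk r; last exact: IH.
by rewrite fk; exact: (order_le0f 0).
Qed.

Lemma order_leW k l f : (k <= l)%N -> order_le k f -> order_le l f.
Proof.
by move=> /subnKC <- fk; elim: (l - k)%N => [|m IH];
  rewrite ?addn0 // addnS; exact: order_leS.
Qed.

Lemma linear_commut f r : linear f -> linear (commut f r).
Proof.
move=> flin a u v; rewrite /commut mulrDr -scalerAr !flin mulrDr -scalerAr.
by rewrite opprD addrACA scalerBr.
Qed.

Lemma commut_comp f g r : linear f ->
  commut (f \o g) r = (f \o commut g r) + (commut f r \o g).
Proof.
move=> flin; apply/funext => p.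
rewrite [RHS]/(f (g (r * p) - r * g p) + (f (r * g p) - r * f (g p))).
rewrite [LHS]/(f (g (r * p)) - r * f (g p)).
have fB u v : f (u - v) = f u - f v 
  by rewrite [u - v]addrC -{1}(scaleN1r v) flin scaleN1r addrC.
have E (a b c : P) : a - c = (a - b) + (b - c) by rewrite addrA subrK.
by rewrite fB; exact: E.
Qed.

Lemma order_le_comp0 k f g : linear f -> order_le 0 f -> linear g ->
  order_le k g -> order_le k (f \o g).
Proof.
move=> flin f0; elim: k g => [|k IH] g glin gk r.
  rewrite commut_comp // f0 gk; apply/funext => p.
  exact: etrans (addr0 (f 0)) (linear_fun0 flin).
rewrite commut_comp // f0 [0 \o g](_ : _ = 0) // addr0.
by apply: IH => //; exact: linear_commut.
Qed.

Lemma order_le_comp k l f g : linear f -> linear g ->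
  order_le k f -> order_le l g -> order_le (k + l) (f \o g).
Proof.
elim: k f l g => [|k IHk] f l g flin glin fk gl; first exact: order_le_comp0.
elim: l g glin gl => [|l IHl] g glin gl r.
  rewrite commut_comp // gl; apply: order_leD; last first.
    by apply: (IHk _ 0%N) => //; exact: linear_commut.
  rewrite [_ \o _](_ : _ = 0); first exact: order_le0f.
  by apply/funext => p /=; rewrite linear_fun0.
change (order_le (k + l.+1) (commut (f \o g) r)); rewrite commut_comp //.
apply: order_leD; last by apply: IHk => //; exact: linear_commut.
by rewrite addnS -addSn; apply: IHl => //; exact: linear_commut.
Qed.

Lemma diffop_submod_closed : submod_closed diffop_pred.
Proof.
split.
  apply/asboolP; split=> [a u v|]; last by exists 0%N; exact: order_le0f.
  exact: esym (etrans (addr0 (a *: (0 : P))) (scaler0 _ _)).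
move=> a f g /asboolP[flin [k fk]] /asboolP[glin [l gl]].
apply/asboolP; split.
  move=> b u v; rewrite [LHS]/(a *: f _ + g _) flin glin.
  have E (x y z t : P) : a *: (b *: x + y) + (b *: z + t) =
      b *: (a *: x + z) + (a *: y + t).
    by rewrite !scalerDr !scalerA addrACA mulrC.
  exact: E.
exists (k + l)%N; apply: order_leD; first apply: order_leZ.
  by apply: order_leW fk; exact: leq_addr.
by apply: order_leW gl; exact: leq_addl.
Qed.

HB.instance Definition _ :=
  GRing.isSubmodClosed.Build K (P -> P) diffop_pred diffop_submod_closed.

Record diffop := Diffop {
  diffop_fun :> P -> P;
  diffop_funP : diffop_fun \in diffop_pred
}.

HB.instance Definition _ := [isSub for diffop_fun].
HB.instance Definition _ := [Choice of diffop by <:].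
HB.instance Definition _ := [SubChoice_isSubLmodule of diffop by <:].

Lemma diffop_linear (u : diffop) : linear u.
Proof. by have /asboolP[] := diffop_funP u. Qed.

Lemma diffop_id : (id : P -> P) \in diffop_pred.
Proof.
apply/asboolP; split=> //; exists 0%N => r.
by apply/funext => p; rewrite /commut subrr.
Qed.

Lemma diffop_comp (u v : diffop) : (u : P -> P) \o v \in diffop_pred.
Proof.
have /asboolP[ulin [k uk]] := diffop_funP u.
have /asboolP[vlin [l vl]] := diffop_funP v.
apply/asboolP; split=> [a p q|]; first by rewrite /= vlin ulin.
by exists (k + l)%N; exact: order_le_comp.
Qed.

Definition one_diffop : diffop := Diffop diffop_id.
Definition mul_diffop (u v : diffop) : diffop := Diffop (diffop_comp u v).

Let dmulA : associative mul_diffop.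
Proof. by move=> u v w; apply/val_inj. Qed.
Let dmul1 : left_id one_diffop mul_diffop.
Proof. by move=> u; apply/val_inj. Qed.
Let dmulr1 : right_id one_diffop mul_diffop.
Proof. by move=> u; apply/val_inj. Qed.
Let dmulDl : left_distributive mul_diffop +%R.
Proof. by move=> u v w; apply/val_inj. Qed.
Let dmulDr : right_distributive mul_diffop +%R.
Proof.
move=> u v w; apply/val_inj/funext => p /=.
by have := diffop_linear u 1 (v p) (w p); rewrite !scale1r.
Qed.
Let one_neq0 : one_diffop != 0.
Proof.
apply/eqP => /(congr1 (fun u : diffop => u 1)).
by rewrite [LHS]/(1 : P) [RHS]/(0 : P) => /eqP; rewrite oner_eq0.
Qed.

HB.instance Definition _ := GRing.Zmodule_isNzRing.Build diffop
  dmulA dmul1 dmulr1 dmulDl dmulDr one_neq0.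

Let scaleAl (a : K) (u v : diffop) : a *: (u * v) = (a *: u) * v.
Proof. exact/val_inj. Qed.
HB.instance Definition _ := GRing.Lmodule_isLalgebra.Build K diffop scaleAl.

Let scaleAr (a : K) (u v : diffop) : a *: (u * v) = u * (a *: v).
Proof.
apply/val_inj/funext => p; have := diffop_linear u a (v p) 0.
by rewrite (linear_fun0 (@diffop_linear u)) !addr0.
Qed.
HB.instance Definition _ := GRing.Lalgebra_isAlgebra.Build K diffop scaleAr.

(* The [K]-linear map sending ['X_[a]] to [\prod_i 'C(a i, b i) *: 'X_[a - b]];
   the coefficient vanishes whenever the subtraction [a - b] is truncated. *)
Definition divpow_fun (b : 'X_{1..n}) (p : P) : P :=
  \sum_(a <- msupp p) (p@_a * (\prod_(i < n) 'C(a i, b i))%N%:R) *: 'X_[a - b].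

Lemma divpow_linear b : linear (divpow_fun b).
Proof.
have divpowwE p k : (msize p <= k)%N -> divpow_fun b p =
    \sum_(a : 'X_{1..n < k})
      (p@_a * (\prod_(i < n) 'C(a i, b i))%N%:R) *: 'X_[a - b].
  pose I : subFinType _ := 'X_{1..n < k}.
  move=> le_pk; rewrite /divpow_fun (big_mksub I) /=; first last.
    by move=> x /msize_mdeg_lt/leq_trans/(_ le_pk).
    by rewrite msupp_uniq.
  rewrite big_rmcond //= => j /memN_msupp_eq0 ->.
  by rewrite mul0r scale0r.
move=> c p q.
pose k := maxn (msize (c *: p + q)) (maxn (msize p) (msize q)).
rewrite !(divpowwE _ k) ?leq_max ?leqnn ?orbT //.
rewrite scaler_sumr -big_split /=; apply: eq_bigr => a _.
by rewrite scalerA -scalerDl mulrA -mulrDl mcoeffD mcoeffZ.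
Qed.

Lemma divpowX b a : divpow_fun b 'X_[a] =
  (\prod_(i < n) 'C(a i, b i))%N%:R *: 'X_[a - b].
Proof. by rewrite /divpow_fun msuppX big_seq1 mcoeffX eqxx mul1r. Qed.

Lemma commut_lin f a r s : linear f ->
  commut f (a *: r + s) = a *: commut f r + commut f s.
Proof.
move=> flin; apply/funext => p.
rewrite [RHS]/(a *: (f (r * p) - r * f p) + (f (s * p) - s * f p)) /commut.
by rewrite !mulrDl -!scalerAl flin scalerBr opprD addrACA.
Qed.

Lemma commutM f r s :
  commut f (r * s) = (commut f r \o *%R s) + ( *%R r \o commut f s).
Proof.
apply/funext => p; rewrite /commut.
have E (x y z : P) : x - r * s * z = (x - r * y) + r * (y - s * z).
  by rewrite mulrBr addrA subrK mulrA.
by rewrite -mulrA; exact: E.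
Qed.

Lemma linear_mul (r : P) : linear ( *%R r).
Proof. by move=> a u v; rewrite mulrDr scalerAr. Qed.

Lemma order_le_mul (r : P) : order_le 0 ( *%R r).
Proof. by move=> s; apply/funext => p; rewrite /commut mulrCA subrr. Qed.

Lemma order_le_gen k f : linear f ->
  (forall i, order_le k (commut f 'X_i)) -> order_le k.+1 f.
Proof.
move=> flin fX r.
have c1 : order_le k (commut f 1).
  rewrite [commut f 1](_ : _ = 0); first exact: order_le0f.
  by apply/funext => p; rewrite /commut !mul1r subrr.
have cM u v : order_le k (commut f u) -> order_le k (commut f v) ->
    order_le k (commut f (u * v)).
  move=> fu fv; rewrite commutM; apply: order_leD.
    rewrite -[k]addn0; apply: order_le_comp => //; last exact: order_le_mul.
      exact: linear_commut.
    exact: linear_mul.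
  apply: order_le_comp0 => //; [exact: linear_mul|exact: order_le_mul|].
  exact: linear_commut.
elim/mpolyind: r => [|a m r _ _ IH].
  rewrite [commut f 0](_ : _ = 0); first exact: order_le0f.
  by apply/funext => p; rewrite /commut !mul0r subr0 linear_fun0.
rewrite commut_lin //; apply: order_leD IH; apply: order_leZ.
rewrite mpolyXE_id; apply: (big_ind (fun r => order_le k (commut f r))) => // i _.
by elim: (m i) => [|j IHj]; rewrite ?expr0 // exprS; exact: cM.
Qed.

Lemma commut_divpow b i : commut (divpow_fun b) 'X_i =
  if b i == 0%N then 0 else divpow_fun (b - U_(i)).
Proof.
pose g := if b i == 0%N then 0 else divpow_fun (b - U_(i)).
have glin : linear g.
  rewrite /g; case: ifP => _; last exact: divpow_linear.
  by move=> c u v; exact: esym (etrans (addr0 (c *: (0 : P))) (scaler0 _ _)).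
have clin := linear_commut 'X_i (@divpow_linear b).
apply/funext; elim/mpolyind => [|c m r _ _ IH]; first by rewrite !linear_fun0.
rewrite clin IH -/g glin; congr (_ *: _ + _).
rewrite /commut -mpolyXD !divpowX.
have prodE (a e : 'X_{1..n}) : (\prod_(j < n) 'C(a j, e j) =
    'C(a i, e i) * \prod_(j < n | j != i) 'C(a j, e j))%N.
  by rewrite (bigD1 i).
rewrite !prodE.
rewrite (eq_bigr (fun j => 'C(m j, b j))); last first.
  by move=> j ji; rewrite mnmDE mnm1E eq_sym (negPf ji).
set Q := (\prod_(j < n | _) _)%N; rewrite mnmDE mnm1E eqxx add1n -scalerAr -mpolyXD.
have XE : ('C(m i, b i) * Q = 0)%N \/ (U_(i) + (m - b) = U_(i) + m - b)%MM.
  have [/forallP le_bm|] := boolP [forall j, (b j <= m j)%N].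
    by right; apply/mnmP => j; rewrite !(mnmDE, mnmBE) addnBA.
  rewrite negb_forall => /existsP[j]; rewrite -ltnNge => lt_mb; left.
  have [ji|ji] := eqVneq j i; first by rewrite bin_small ?mul0n // -ji.
  by rewrite /Q (bigD1 j) //= (bin_small lt_mb) mul0n muln0.
have -> : ('C(m i, b i) * Q)%N%:R *: 'X_[U_(i) + (m - b)] =
    ('C(m i, b i) * Q)%N%:R *: 'X_[U_(i) + m - b] :> P.
  by case: XE => ->; rewrite ?scale0r.
rewrite -scalerBl /g; have [bi0|bi_neq0] := eqVneq (b i) 0%N.
  by rewrite bi0 !bin0 subrr scale0r.
rewrite divpowX prodE mnmBE mnm1E eqxx.
rewrite (eq_bigr (fun j => 'C(m j, b j))); last first.
  by move=> j ji; rewrite mnmBE mnm1E eq_sym (negPf ji) subn0.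
rewrite -/Q; congr (_ *: 'X_[_]).
  case: (b i) bi_neq0 => // e _.
  by rewrite binS mulnDl natrD addrAC subrr add0r subn1.
apply/mnmP => j; rewrite !(mnmDE, mnmBE) mnm1E; case: eqVneq => [<-|_]; last first.
  by rewrite add0n subn0.
by case: (b i) bi_neq0 => // e _; rewrite subSS subn1 addKn || rewrite add1n subSS subn1.
Qed.

Lemma order_le_divpow b : order_le (mdeg b) (divpow_fun b).
Proof.
have [k] := ubnP (mdeg b); elim: k b => // k IH b lt_bk.
have [b0|] := posnP (mdeg b).
  rewrite b0 => r /=; apply/funext => p.
  have b0' i : b i = 0%N by move/eqP: b0; rewrite mdeg_eq0 => /eqP ->; rewrite mnmE.
  have dE q : divpow_fun b q = q.
    rewrite [RHS]mpolyE; apply: eq_bigr => a _.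
    rewrite big1 => [|i _]; last by rewrite b0' bin0.
    by rewrite mulr1; congr (_ *: 'X_[_]); apply/mnmP => i; rewrite mnmBE b0' subn0.
  by rewrite /commut !dE subrr.
move=> b_gt0; rewrite -(prednK b_gt0); apply: order_le_gen => [|i].
  exact: divpow_linear.
rewrite commut_divpow; case: ifP => [_|/negbT bi]; first exact: order_le0f.
have mE : mdeg (b - U_(i))%MM = (mdeg b).-1.
  have <- : (b - U_(i) + U_(i))%MM = b.
    by apply/mnmP => j; rewrite mnmDE mnmBE mnm1E; case: eqVneq => [<-|_];
      rewrite ?subn0 ?addn0 // subnK // lt0n.
  rewrite mdegD mdeg1 addn1 /=; congr mdeg.
  by apply/mnmP => j; rewrite !(mnmBE, mnmDE) addnK.
by rewrite -mE; apply: IH; rewrite mE prednK.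
Qed.

Lemma mul_divpowP (a b : 'X_{1..n}) :
  (fun p => 'X_[a] * divpow_fun b p) \in diffop_pred.
Proof.
apply/asboolP; split=> [c p q|]; first by rewrite divpow_linear mulrDr scalerAr.
exists (mdeg b); apply: (@order_le_comp0 _ ( *%R 'X_[a])).
- exact: linear_mul.
- exact: order_le_mul.
- exact: divpow_linear.
- exact: order_le_divpow.
Qed.

(* The operator $x^a \partial^{[b]}$. *)
Definition mul_divpow (a b : 'X_{1..n}) : diffop := Diffop (mul_divpowP a b).

Definition canonical_filtration (i : nat) : set diffop :=
  kspan [set u | exists a b : 'X_{1..n},
                   (mdeg a + mdeg b <= i)%N /\ u = mul_divpow a b].

End DiffOp.

Section DiffOpModules.
Context (K : fieldType) (n : nat).

(* [M] as a [K]-vector space, through [K -> diffop K n]. *)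
Definition restrict_scalars (M : lmodType (diffop K n)) : Type := M.

Section RestrictScalars.
Variable M : lmodType (diffop K n).
Local Notation MK := (restrict_scalars M).

HB.instance Definition _ := GRing.Zmodule.copy MK M.

Definition scaleK (a : K) (m : MK) : MK := (a%:A : diffop K n) *: (m : M).

Let scaleKA (a b : K) (m : MK) : scaleK a (scaleK b m) = scaleK (a * b) m.
Proof. by rewrite /scaleK scalerA -scalerAl mul1r scalerA. Qed.
Let scaleK1 : left_id 1 scaleK.
Proof. by move=> m; rewrite /scaleK scale1r [LHS]scale1r. Qed.
Let scaleKDr : right_distributive scaleK +%R.
Proof. by move=> a u v; exact: scalerDr. Qed.
Let scaleKDl (m : MK) : {morph scaleK^~ m : a b / a + b}.
Proof. by move=> a b; rewrite /scaleK scalerDl; exact: scalerDl. Qed.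

HB.instance Definition _ := GRing.Zmodule_isLmodule.Build K MK
  scaleKA scaleK1 scaleKDr scaleKDl.
End RestrictScalars.

Context (M : lmodType (diffop K n)).
Local Notation MK := (restrict_scalars M).

(* For [A] stable under [K] this is the set of finite sums of products
   [u *: m]. *)
Definition act (A : set (diffop K n)) (M0 : set MK) : set MK :=
  kspan [set (u *: (m : M) : MK) | u in A & m in M0].

Definition generates (M0 : set MK) : Prop := act setT M0 = setT.

Definition hilbert_fun (M0 : set MK) (i : nat) : nat :=
  kdim (act (canonical_filtration i) M0).

(* The last condition does not depend on the choice of [M0]. *)
Definition holonomic : Prop :=
  (exists m : M, m != 0) /\
  exists M0 : set MK, [/\ fin_dim_subspace M0, generates M0 &
    exists q : {poly rat}, size q = n.+1 /\
      \forall i \near \oo, (hilbert_fun M0 i)%:R <= q.[i%:R]].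

Definition is_submodule (N : set M) : Prop :=
  N 0 /\ forall (u : diffop K n) (v w : M), N v -> N w -> N (u *: v + w).

(* [N i.+1 / N i] is simple: it is nonzero, and there is no submodule strictly
   between [N i] and [N i.+1]. *)
Definition composition_series (d : nat) (N : nat -> set M) : Prop :=
  [/\ N 0%N = [set 0], N d = setT,
      forall i, (i <= d)%N -> is_submodule (N i) &
      forall i, (i < d)%N ->
        [/\ N i `<=` N i.+1, N i <> N i.+1 &
            forall L, is_submodule L -> N i `<=` L -> L `<=` N i.+1 ->
              L = N i \/ L = N i.+1]].

(* By Jordan--Hoelder the length [d] is unique. *)
Definition has_length (d : nat) : Prop := exists N, composition_series d N.

End DiffOpModules.

(* Main.v *)
(** Every proper left ideal [I] of the ring of differential operators satisfies
    [dim F_i / (F_i ∩ I) >= C(n + i, n)]. Put [q = p^i] and let [al] be the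
    largest multi-index with entries below [q] such that the divided power
    [d^[al]] is not in [I]. If [g + b = al + a], then
    [d^[g] x^a d^[b] = C(al, b) d^[al]] modulo [I], whereas the left side lies
    in [I] when [g + b > al + a]; here it matters that [C(b + c, b) = 0] modulo
    [p] as soon as [b, c < q <= b + c]. Hence operators [x^a d^[b]] with
    [C(al, b) != 0] and distinct [g = al + a - b < q] are independent modulo
    [I]. Moving each base [p] digit separately, every [t] with [|t| <= i] yields
    its own such [g] at the cost [|a| + |b| <= |t|], by Lucas' theorem.

    Applied to the successive quotients of a chain of [d] submodules, this gives
    [d C(n + i, n) <= dim F_(i + k) M_0] for some [k] and all [i]. So chains in a
    holonomic module have bounded length, and a longest one is a composition
    series. *)
Require Import Defs.
From mathcomp Require Import all_boot all_order all_algebra.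
From mathcomp Require Import boolp classical_sets functions reals topology.
Import Order.TTheory GRing.Theory Num.Theory.
Local Open Scope classical_set_scope.
Local Open Scope ring_scope.

(* The grammars of [mpoly] and [normedtype] clash, hence the module: it confines
   the notations of [mpoly]. *)
Module DiffOpLength.
From mathcomp Require Import ssrcomplements mpoly zify lra.

Set Implicit Arguments.
Unset Strict Implicit.
Unset Printing Implicit Defensive.

(** * Binomial coefficients in characteristic [p] *)

Section Binomials.
Context (K : idomainType) (p : nat) (charK : p \in [pchar K]).

(** In [j * C(p^k, j) = p^k * C(p^k - 1, j - 1)] the right side has [p]-adic valuation at least [k],
    while that of [j] is below [k]. *)
Lemma bin_pow_pchar k j : (0 < j < p ^ k)%N -> 'C(p ^ k, j)%:R = 0 :> K.
Proof.
case/andP=> j0 jq; have p_pr := pcharf_prime charK.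
apply/eqP; rewrite -(dvdn_pcharf charK).
have C0 : (0 < 'C(p ^ k, j))%N by rewrite bin_gt0 ltnW.
have E : (j * 'C(p ^ k, j) = p ^ k * 'C((p ^ k).-1, j.-1))%N.
  by rewrite mul_bin_diag prednK.
have lgE := congr1 (logn p) E.
have q0 : (0 < p ^ k)%N by rewrite expn_gt0 prime_gt0.
have C'0 : (0 < 'C((p ^ k).-1, j.-1))%N by rewrite bin_gt0; lia.
rewrite !lognM // pfactorK // in lgE.
have jk : (logn p j < k)%N.
  rewrite -(ltn_exp2l _ _ (prime_gt1 p_pr)); apply: leq_ltn_trans jq.
  by apply: dvdn_leq => //; exact: pfactor_dvdnn.
have : (0 < logn p 'C(p ^ k, j))%N by lia.
by rewrite logn_gt0 mem_primes => /and3P[].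
Qed.

(** These are the coefficients of [(1 + X^(p^k)) (1 + X)^m], to which [(1 + X)^(p^k + m)] reduces.
    In the Vandermonde sum only the indices 0 and [p^k] survive. *)
Lemma bin_add_pow k m j : 'C(p ^ k + m, j)%:R =
  'C(m, j)%:R + (if (p ^ k <= j)%N then 'C(m, j - p ^ k)%:R else 0) :> K.
Proof.
have q0 : (0 < p ^ k)%N by rewrite expn_gt0 prime_gt0 // (pcharf_prime charK).
rewrite -binomial.Vandermonde natr_sum big_ord_recl /= bin0 mul1n subn0.
congr (_ + _); case: ifP => [qj|/negbT]; last first.
  rewrite -ltnNge => jq; apply: big1 => i _.
  rewrite natrM bin_pow_pchar ?mul0r //; rewrite /bump /=; have := ltn_ord i; lia.
have lt_qj : ((p ^ k).-1 < j)%N by lia.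
rewrite (bigD1 (Ordinal lt_qj)) //= big1 => [|i iq].
  by rewrite /bump /= add1n prednK // binn mul1n addr0.
have [lt_iq|le_qi] := ltnP i.+1 (p ^ k).
  by rewrite natrM bin_pow_pchar ?mul0r //; rewrite /bump /=; lia.
rewrite [('C(p ^ k, _))]bin_small ?mul0n //; rewrite /bump /=.
by move: iq; rewrite -val_eqE /=; lia.
Qed.

(** Here [c + b = p^k + m] with [m < b < p^k], so both terms of [bin_add_pow] vanish. *)
Lemma bin_carry k b c : (b < p ^ k)%N -> (c < p ^ k)%N -> (p ^ k <= c + b)%N ->
  'C(c + b, b)%:R = 0 :> K.
Proof.
move=> bq cq qbc; rewrite -(subnKC qbc) bin_add_pow.
by rewrite [(p ^ k <= b)%N]leqNgt bq addr0 bin_small //; lia.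
Qed.

(** Lucas' theorem with only the last [k] digits split off: by [bin_add_pow], raising [A] by one
    obeys Pascal's rule in [B]. *)
Lemma lucas k A B r s : (r < p ^ k)%N -> (s < p ^ k)%N ->
  'C(A * p ^ k + r, B * p ^ k + s)%:R = 'C(A, B)%:R * 'C(r, s)%:R :> K.
Proof.
move=> rq sq; elim: A B => [|A IH] [|B].
- by rewrite !mul0n !add0n bin0 mul1r.
- by rewrite bin_small ?bin0n ?mul0r //; lia.
- rewrite mulSn -addnA bin_add_pow.
  have := IH 0%N; rewrite mul0n add0n => ->.
  by rewrite [(_ <= s)%N]leqNgt sq addr0 !bin0.
rewrite mulSn -addnA bin_add_pow IH mulSn -addnA leq_addr addKn IH.
by rewrite binS natrD mulrDl.
Qed.

Lemma bin_lt_pchar a b : (b <= a < p)%N -> 'C(a, b)%:R != 0 :> K.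
Proof.
case/andP=> ba ap; rewrite -(dvdn_pcharf charK).
have p_pr := pcharf_prime charK.
have fact_ndvd m : (m < p)%N -> ~~ (p %| m`!)%N.
  elim: m => [|m IH] mp; first by rewrite dvdn1 neq_ltn prime_gt1 ?orbT.
  by rewrite factS Euclid_dvdM // negb_or gtnNdvd //= IH // ltnW.
apply: contra (fact_ndvd a ap) => /(dvdn_mulr (b`! * (a - b)`!)).
by rewrite bin_fact.
Qed.

(* Injective in [T], and moves [A] by at most [T] without leaving [0, p). *)
Definition move_digit (A T : nat) : nat := if (T <= A)%N then (A - T)%N else T.

Lemma move_digit_inj A : injective (move_digit A).
Proof. by rewrite /move_digit => T T'; case: ifP; case: ifP; lia. Qed.

Lemma lt_move_digit A T m : (A < m)%N -> (T < m)%N -> (move_digit A T < m)%N.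
Proof. by rewrite /move_digit; case: ifP; lia. Qed.

Lemma move_digit_dist A T :
  (move_digit A T - A + (A - move_digit A T) <= T)%N.
Proof. by rewrite /move_digit; case: ifP; lia. Qed.

(** The choice of exponents in one variable. Each digit of [al] is moved by [move_digit] according
    to the same digit of [t]; [a t] collects the increases and [b t] the decreases. No digit of
    [b t] exceeds that of [al], so Lucas' theorem gives a nonzero coefficient. *)
Lemma bin_neq0_shift k al : (al < p ^ k)%N ->
  exists g a b : nat -> nat,
    {in gtn (p ^ k)%N &, injective g} /\ forall t, (t < p ^ k)%N ->
      [/\ (g t < p ^ k)%N, (g t + b t = al + a t)%N, (a t + b t <= t)%N &
          'C(al, b t)%:R != 0 :> K].
Proof.
have p_gt0 : (0 < p)%N by rewrite prime_gt0 // (pcharf_prime charK).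
elim: k al => [|k IH] al lt_al.
  exists (fun=> 0%N), (fun=> 0%N), (fun=> 0%N); split=> [t u|t _].
    by rewrite !inE !expn0 !ltnS !leqn0 => /eqP -> /eqP ->.
  by rewrite expn0 bin0 oner_neq0; split=> //; move: lt_al; rewrite expn0; lia.
set q := (p ^ k)%N in IH *.
have q_gt0 : (0 < q)%N by rewrite expn_gt0 p_gt0.
have divE t : t = (t %/ q * q + t %% q)%N := divn_eq t q.
have ltd t : (t < p ^ k.+1)%N -> (t %/ q < p)%N.
  by rewrite ltn_divLR // expnS.
have [g [a [b [g_inj gP]]]] := IH _ (ltn_pmod al q_gt0).
set A := (al %/ q)%N; pose G T := move_digit A T.
(* The top digit is [t %/ q]; the lower [k] digits come from the induction hypothesis for
   [al %% q]. *)
exists (fun t => G (t %/ q) * q + g (t %% q))%N.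
exists (fun t => (G (t %/ q) - A) * q + a (t %% q))%N.
exists (fun t => (A - G (t %/ q)) * q + b (t %% q))%N.
have ltA := ltd _ lt_al; split.
  move=> t u tq uq /= E.
  have [gt _ _ _] := gP _ (ltn_pmod t q_gt0).
  have [gu _ _ _] := gP _ (ltn_pmod u q_gt0).
  have E1 := congr1 (divn^~ q) E; have E2 := congr1 (modn^~ q) E.
  rewrite /= !divnMDl // (divn_small gt) (divn_small gu) !addn0 in E1.
  rewrite /= !modnMDl (modn_small gt) (modn_small gu) in E2.
  rewrite (divE t) (divE u) (move_digit_inj E1).
  by rewrite (g_inj _ _ _ _ E2) // inE ltn_pmod.
move=> t tq; have [gt ge ab C0] := gP _ (ltn_pmod t q_gt0).
have ltT := ltd _ tq; have ltG : (G (t %/ q) < p)%N by exact: lt_move_digit.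
split.
- rewrite expnS -/q; apply: (@leq_trans ((G (t %/ q)).+1 * q)%N).
    by rewrite mulSn addnC ltn_add2r.
  by rewrite leq_mul2r ltG orbT.
- rewrite [in RHS](divE al) -/A.
  have -> : (A * q + al %% q + ((G (t %/ q) - A) * q + a (t %% q)) =
     (A + (G (t %/ q) - A)) * q + (g (t %% q) + b (t %% q)))%N by lia.
  rewrite addnACA -mulnDl; congr (_ * _ + _)%N; lia.
- rewrite [leqRHS](divE t) addnACA -mulnDl leq_add // leq_mul2r; apply/orP; right.
  exact: move_digit_dist.
- have lt_b : (b (t %% q) < q)%N.
    apply: leq_ltn_trans (ltn_pmod t q_gt0).
    by apply: leq_trans ab; exact: leq_addl.
  rewrite [al in 'C(al, _)]divE -/A lucas ?ltn_pmod //.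
  by rewrite mulf_neq0 // bin_lt_pchar // leq_subr.
Qed.
End Binomials.

(** Both sides are the multinomial coefficient [m! / (b! c! (m - b - c)!)], or 0 if [b + c > m]. It
    governs the composite of two divided powers on a monomial. *)
Lemma bin_mul_bin m b c :
  ('C(m, c) * 'C(m - c, b) = 'C(b + c, c) * 'C(m, b + c))%N.
Proof.
have [le_m|lt_m] := leqP (b + c) m; last first.
  rewrite (bin_small lt_m) muln0; have [mc|cm] := ltnP m c.
    by rewrite (bin_small mc).
  by rewrite ['C(m - c, b)]bin_small ?muln0 //; lia.
have c_le : (c <= m)%N by lia.
have b_le : (b <= m - c)%N by lia.
have D : (0 < c`! * (b`! * (m - c - b)`!))%N by rewrite !muln_gt0 !fact_gt0.
apply/eqP; rewrite -(eqn_pmul2r D); apply/eqP.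
transitivity m`!.
  rewrite -(bin_fact c_le) -(bin_fact b_le); lia.
have E1 := bin_fact (leq_addl b c); have E2 := bin_fact le_m.
rewrite addnK in E1; have E3 : (m - c - b = m - (b + c))%N by lia.
rewrite -E2 -E1 E3; lia.
Qed.

(** * Products of operators and the canonical filtration *)

Section DiffOpRing.
Context (K : fieldType) (n : nat).
Local Notation D := (diffop K n).
Local Notation F := (@canonical_filtration K n).
Local Notation xd := (mul_divpow K).

Lemma diffopD (u v : D) p : (u + v) p = u p + v p.
Proof. by []. Qed.

Lemma diffopZ c (u : D) p : (c *: u) p = c *: u p.
Proof. by []. Qed.

Lemma diffop_eqX (u v : D) : (forall m, u 'X_[m] = v 'X_[m]) -> u = v.
Proof.
move=> uv; apply/val_inj/funext => r.
have ulin := @diffop_linear _ _ u; have vlin := @diffop_linear _ _ v.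
elim/mpolyind: r => [|c m r _ _ /= IH]; first by rewrite /= !linear_fun0.
by rewrite /= ulin vlin uv IH.
Qed.

Lemma mul_divpowX (a b m : 'X_{1..n}) : xd a b 'X_[m] =
  (\prod_(i < n) 'C(m i, b i))%N%:R *: 'X_[a + (m - b)].
Proof. by rewrite /= divpowX -scalerAr -mpolyXD. Qed.

Lemma mul_divpow0X (a m : 'X_{1..n}) : xd a 0 'X_[m] = 'X_[a + m].
Proof.
rewrite mul_divpowX big1 ?scale1r => [|i _]; last by rewrite mnm0E bin0.
by congr 'X_[_]; apply/mnmP => i; rewrite !mnmDE mnmBE mnm0E subn0.
Qed.

Lemma mul_divpow00 : xd 0 0 = 1 :> D.
Proof.
by apply: diffop_eqX => m; rewrite mul_divpow0X add0m.
Qed.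

Lemma mul_divpow_x (a c b : 'X_{1..n}) : xd a 0 * xd c b = xd (a + c) b :> D.
Proof.
apply: diffop_eqX => m.
have -> : (xd a 0 * xd c b) 'X_[m] = xd a 0 (xd c b 'X_[m]) by [].
rewrite !mul_divpowX -[_ *: 'X_[c + _]]addr0 diffop_linear mul_divpow0X.
by rewrite (linear_fun0 (@diffop_linear _ _ _)) addr0 addmA.
Qed.

Lemma mul_divpow_d (b c : 'X_{1..n}) : xd 0 b * xd 0 c =
  (\prod_(i < n) 'C(b i + c i, c i))%N%:R *: xd 0 (b + c) :> D.
Proof.
apply: diffop_eqX => m.
have -> : (xd 0 b * xd 0 c) 'X_[m] = xd 0 b (xd 0 c 'X_[m]) by [].
rewrite diffopZ !mul_divpowX -[_ *: 'X_[0 + (m - c)]]addr0 diffop_linear.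
rewrite (linear_fun0 (@diffop_linear _ _ _)) addr0 mul_divpowX !scalerA -!natrM.
rewrite -!big_split /=; congr (_ *: 'X_[_]); last first.
  by apply/mnmP => i; rewrite !(mnmDE, mnmBE) mnm0E; lia.
congr (_%:R); apply: eq_bigr => i _.
by rewrite !(mnmDE, mnmBE) mnm0E bin_mul_bin.
Qed.

(** The case distinction is forced by truncated subtraction: for [b i = 0] the commutator is zero,
    but [b - U_(i)] is [b]. *)
Lemma mul_divpow_dx (b : 'X_{1..n}) i : xd 0 b * xd U_(i) 0 =
  xd U_(i) b + (if b i == 0%N then 0 else xd 0 (b - U_(i))) :> D.
Proof.
apply/val_inj/funext => r.
have E := congr1 (fun f => f r) (@commut_divpow K n b i).
rewrite /commut /= in E.
have d0 (s : {mpoly K[n]}) : divpow_fun 0 s = s.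
  have -> : divpow_fun 0 s = xd 0 0 s by rewrite /= mpolyX0 mul1r.
  by rewrite mul_divpow00.
rewrite [LHS]/(xd 0 b (xd U_(i) 0 r)) /= !mpolyX0 !mul1r d0.
rewrite [LHS](_ : _ = 'X_i * divpow_fun b r +
  (divpow_fun b ('X_i * r) - 'X_i * divpow_fun b r)).
  rewrite E; case: ifP => _ //=.
  by rewrite [RHS]/('X_i * divpow_fun b r +
    'X_[0] * divpow_fun (b - U_(i)) r) mpolyX0 mul1r.
by rewrite addrC subrK.
Qed.

Lemma mnm_ind (P : 'X_{1..n} -> Prop) :
  P 0%MM -> (forall i a, P a -> P (U_(i) + a)%MM) -> forall a, P a.
Proof.
move=> P0 PU a; have [k] := ubnP (mdeg a); elim: k a => // k IH a ak.
have [->//|/eqP/eqP a0] := eqVneq a 0%MM.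
have [i ai] : exists i, a i != 0%N.
  apply/existsP; apply: contraNT a0; rewrite negb_exists => /forallP a0.
  by apply/eqP/mnmP => i; rewrite mnm0E; apply/eqP; have := a0 i; rewrite negbK.
have aE : a = (U_(i) + (a - U_(i)))%MM.
  apply/mnmP => j; rewrite mnmDE mnmBE mnm1E; case: eqVneq => [<-|_] /=; lia.
rewrite aE; apply/PU/IH; move: ak; rewrite {1}aE mdegD mdeg1; lia.
Qed.

Lemma kspan_submod (V : lmodType K) (A : set V) :
  kspan A 0 /\ forall c u v, kspan A u -> kspan A v -> kspan A (c *: u + v).
Proof.
split; first by exists 0%N, (fun=> 0), (fun=> 0); split=> [[]//|]; rewrite big_ord0.
move=> c u v [d [s [x [sA ->]]]] [e [t [y [tA ->]]]].
exists (d + e)%N.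
exists (fun i => match fintype.split i with inl j => s j | inr j => t j end).
exists (fun i => match fintype.split i with inl j => c * x j | inr j => y j end).
split=> [i|]; first by case: fintype.split.
rewrite big_split_ord /= scaler_sumr; congr (_ + _); apply: eq_bigr => i _.
  by rewrite -[lshift _ _]/(unsplit (inl i)) unsplitK scalerA.
by rewrite -[rshift _ _]/(unsplit (inr i)) unsplitK.
Qed.

Lemma sub_kspan (V : lmodType K) (A : set V) : A `<=` kspan A.
Proof.
move=> v Av; exists 1%N, (fun=> v), (fun=> 1); split=> //.
by rewrite big_ord1 scale1r.
Qed.

Lemma kspan_ind (V : lmodType K) (A : set V) (B : V -> Prop) :
  B 0 -> (forall c u v, B u -> B v -> B (c *: u + v)) ->
  (forall v, A v -> B v) -> forall v, kspan A v -> B v.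
Proof.
move=> B0 BD AB v [d [s [c [sA ->]]]].
by elim/big_ind: _ => // [x y Bx By|i _]; [rewrite -[x]scale1r; apply: BD|
  rewrite -[_ *: _]addr0; apply: BD => //; exact: AB].
Qed.

Lemma kspan_min (V : lmodType K) (A B : set V) :
  B 0 -> (forall c u v, B u -> B v -> B (c *: u + v)) -> A `<=` B ->
  kspan A `<=` B.
Proof. by move=> B0 BD AB; exact: kspan_ind. Qed.

Lemma kspanS (V : lmodType K) (A B : set V) : A `<=` B -> kspan A `<=` kspan B.
Proof.
move=> AB; have [B0 BD] := kspan_submod B; apply: kspan_min => //.
exact: subset_trans (@sub_kspan _ B).
Qed.

Lemma filtS i j : (i <= j)%N -> F i `<=` F j.
Proof.
move=> ij; apply: kspanS => u [a [b [ab ->]]].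
by exists a, b; split=> //; exact: leq_trans ij.
Qed.

Lemma filt_xd (a b : 'X_{1..n}) i : (mdeg a + mdeg b <= i)%N -> F i (xd a b).
Proof. by move=> ab; apply: sub_kspan; exists a, b. Qed.

Lemma filtD i c (u v : D) : F i u -> F i v -> F i (c *: u + v).
Proof. by have [_] := kspan_submod [set u | exists a b : 'X_{1..n},
                   (mdeg a + mdeg b <= i)%N /\ u = xd a b]; apply. Qed.

Lemma filt0 i : F i 0.
Proof. by have [] := kspan_submod [set u | exists a b : 'X_{1..n},
                   (mdeg a + mdeg b <= i)%N /\ u = xd a b]. Qed.

Lemma filt_min i (B : D -> Prop) :
  B 0 -> (forall c u v, B u -> B v -> B (c *: u + v)) ->
  (forall a b : 'X_{1..n}, (mdeg a + mdeg b <= i)%N -> B (xd a b)) ->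
  forall u, F i u -> B u.
Proof.
by move=> B0 BD Bxd; apply: kspan_min => // _ [a [b [ab ->]]]; exact: Bxd.
Qed.

Lemma filt_mulx (a : 'X_{1..n}) i (u : D) : F i u -> F (mdeg a + i) (xd a 0 * u).
Proof.
move: u; apply: filt_min => [|c v w vF wF|c b cb].
- by rewrite mulr0; exact: filt0.
- by rewrite mulrDr -scalerAr; exact: filtD.
- by rewrite mul_divpow_x; apply: filt_xd; rewrite mdegD -addnA leq_add2l.
Qed.

(** Induction on the exponent [a] of [x] in the right factor. Moving one variable left across the
    divided power gives a term with that variable in front and a term of lower degree. *)
Lemma filt_muld (b : 'X_{1..n}) i (u : D) : F i u -> F (mdeg b + i) (xd 0 b * u).
Proof.
move: u; apply: filt_min => [|c v w vF wF|a c ac].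
- by rewrite mulr0; exact: filt0.
- by rewrite mulrDr -scalerAr; exact: filtD.
elim/mnm_ind: a b i ac => [|j a IH] b i ac.
  rewrite mul_divpow_d -[_ *: _]addr0; apply: filtD (filt0 _).
  by apply: filt_xd; move: ac; rewrite mdegD mdeg0; lia.
rewrite -mul_divpow_x mulrA mul_divpow_dx mulrDl -[_ * xd a c]scale1r.
have ac' : (mdeg a + mdeg c <= i.-1)%N by move: ac; rewrite mdegD mdeg1; lia.
have i0 : (0 < i)%N by move: ac; rewrite mdegD mdeg1; lia.
apply: filtD.
  rewrite -[U_(j)%MM]addm0 -mul_divpow_x -mulrA.
  have -> : (mdeg b + i = mdeg (U_(j) : 'X_{1..n}) + (mdeg b + i.-1))%N.
    by rewrite mdeg1; lia.
  by apply: filt_mulx; exact: IH.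
case: ifP => _; first by rewrite mul0r; exact: filt0.
apply: filtS (IH (b - U_(j))%MM _ ac').
by apply: leq_add; [exact: mdegB|exact: leq_pred].
Qed.

Lemma filtM i j (u v : D) : F i u -> F j v -> F (i + j) (u * v).
Proof.
move=> uF vF; move: u uF; apply: filt_min => [|c w z wF zF|a b ab].
- by rewrite mul0r; exact: filt0.
- by rewrite mulrDl -scalerAl; exact: filtD.
rewrite -[a]addm0 -mul_divpow_x -mulrA.
apply: (@filtS (mdeg a + (mdeg b + j))); first by rewrite addnA leq_add2r.
exact/filt_mulx/filt_muld.
Qed.
End DiffOpRing.

(** * Every differential operator lies in the canonical filtration *)

Section Exhaustion.
Context (K : fieldType) (n : nat).
Local Notation P := {mpoly K[n]}.
Local Notation D := (diffop K n).
Local Notation F := (@canonical_filtration K n).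
Local Notation xd := (mul_divpow K).

(** The commutator of [f] with a variable has smaller order and kills the monomials of the smaller
    degrees, hence is zero by induction. Then [f] commutes with all variables and kills 1. *)
Lemma order_le_eq0 k (f : P -> P) : linear f -> order_le k f ->
  (forall m : 'X_{1..n}, (mdeg m <= k)%N -> f 'X_[m] = 0) -> f = 0.
Proof.
elim: k f => [|k IH] f flin fk f0.
  apply/funext => r; have := congr1 (fun g => g 1) (fk r).
  rewrite /commut mulr1 -[in r * _]mpolyX0 f0 ?mdeg0 // mulr0 subr0.
  by move=> ->.
have fX i r : f ('X_i * r) = 'X_i * f r.
  apply/eqP; rewrite -subr_eq0; apply/eqP.
  have /(congr1 (fun g => g r)) // : commut f 'X_i = 0.
  apply: IH => // [|m mk]; first exact: linear_commut.
  by rewrite /commut -mpolyXD !f0 ?mulr0 ?subr0 // ?mdegD ?mdeg1 //; lia.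
have f0' : forall m, f 'X_[m] = 0.
  apply: mnm_ind => [|i a IHa]; first by rewrite f0 // mdeg0.
  by rewrite mpolyXD fX IHa mulr0.
apply/funext => r; elim/mpolyind: r => [|c m r _ _ IHr].
  by rewrite linear_fun0.
by rewrite flin f0' IHr scaler0 addr0.
Qed.

(** Take the sum of [h b] times the divided power of exponent [b] over all [b] of degree [d]. Among
    monomials of degree at most [d], that divided power sends the one of exponent [b] to 1 and the
    others to 0. *)
Lemma diffop_interp d (h : 'X_{1..n} -> P) : exists g : D,
  [/\ exists k, F k g, order_le d g &
      forall m : 'X_{1..n}, (mdeg m <= d)%N ->
        g 'X_[m] = if mdeg m == d then h m else 0].
Proof.
pose U (g : D) := (exists k, F k g) /\ order_le d g.
have UD c g g' : U g -> U g' -> U (c *: g + g').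
  move=> [[k gk] go] [[k' gk'] go']; split; last first.
    by apply: (@order_leD _ _ d (c *: (g : P -> P)) g') => //; exact: order_leZ.
  exists (maxn k k'); apply: filtD.
    by apply: filtS gk; exact: leq_maxl.
  by apply: filtS gk'; exact: leq_maxr.
have U0 : U 0 by split; [exists 0%N; exact: filt0|exact: (order_le0f K n d)].
have Usum I (r : seq I) (Q : pred I) (c : I -> K) (g : I -> D) :
    (forall i, Q i -> U (g i)) -> U (\sum_(i <- r | Q i) c i *: g i).
  move=> Ug; elim/big_rec: _ => // i v Qi Uv; apply: UD => //; exact: Ug.
have Uxd a b : mdeg b = d -> U (xd a b).
  move=> bd; split; first by exists (mdeg a + mdeg b)%N; exact: filt_xd.
  rewrite -bd; apply: (@order_le_comp0 _ _ _ ( *%R 'X_[a])).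
  - exact: linear_mul.
  - exact: order_le_mul.
  - exact: divpow_linear.
  - exact: order_le_divpow.
pose t (b : 'X_{1..n < d.+1}) : D := \sum_(a <- msupp (h b)) (h b)@_a *: xd a b.
have sumE I (r : seq I) (Q : pred I) (g : I -> D) q :
    (\sum_(i <- r | Q i) g i : D) q = \sum_(i <- r | Q i) (g i q).
  by elim/big_rec2: _ => // i y1 y2 _ <-.
have tE b q : t b q = h b * divpow_fun b q.
  rewrite sumE [h b in RHS]mpolyE mulr_suml; apply: eq_bigr => a _.
  by rewrite diffopZ -scalerAl.
exists (\sum_(b : 'X_{1..n < d.+1} | mdeg b == d) t b).
have [] : U (\sum_(b : 'X_{1..n < d.+1} | mdeg b == d) t b).
  elim/big_rec: _ => // b v /eqP bd Uv; rewrite -[t b]scale1r; apply: UD => //.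
  by apply: Usum => a _; exact: Uxd.
move=> Fg og; split=> // m md; rewrite sumE.
have tX (b : 'X_{1..n < d.+1}) : mdeg b = d -> t b 'X_[m] =
    if (b : 'X_{1..n}) == m then h m else 0.
  move=> bd; rewrite tE divpowX; case: eqVneq => [->|bm].
    rewrite big1 ?scale1r => [|i _]; last by rewrite binn.
    by rewrite -[RHS]mulr1 -mpolyX0; congr (_ * 'X_[_]); apply/mnmP => i;
       rewrite mnmBE mnm0E subnn.
  (* Since [mdeg m <= mdeg b] and [m] differs from [b], some entry of [m] is smaller, and there the
     binomial coefficient vanishes. *)
  have /existsP[i lt_mb] : [exists i, (m i < b i)%N].
    apply: contraNT bm; rewrite negb_exists => /forallP bm.
    have bm' : (b <= m)%MM by apply/mnm_lepP => i; rewrite leqNgt bm.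
    have mE : (m = b + (m - b))%MM by rewrite addmC submK.
    have : mdeg (m - b)%MM == 0%N by move: md; rewrite {1}mE mdegD bd; lia.
    by rewrite mdeg_eq0 => /eqP mb; rewrite mE mb addm0.
  by rewrite (bigD1 i) //= (bin_small lt_mb) mul0n scale0r mulr0.
rewrite (eq_bigr (fun b : 'X_{1..n < d.+1} => if (b : 'X_{1..n}) == m then h m else 0)).
  have lt_md : (mdeg m < d.+1)%N by [].
  case: ifP => md'.
    rewrite (bigD1 (BMultinom lt_md)) //= eqxx big1 ?addr0 // => b.
    by case/andP=> _; rewrite -val_eqE /= => /negPf ->.
  rewrite big1 // => b /eqP bd; case: eqP => // bm.
  by rewrite -bm bd eqxx in md'.
by move=> b /eqP/tX.
Qed.

(** An operator of order at most [k] is determined by its values on monomials of degree at most [k].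
    These values are matched degree by degree within the filtration, by operators of order at most
    [k]. *)
Lemma filt_exhaustive (u : D) : exists k, F k u.
Proof.
have /asboolP[ulin [k uk]] := diffop_funP u.
have approx d : (d <= k.+1)%N ->
  exists g : D, [/\ exists l, F l g, order_le k g &
    forall m : 'X_{1..n}, (mdeg m < d)%N -> u 'X_[m] = g 'X_[m]].
  elim: d => [|d IH] dk.
    by exists 0; split=> //; [exists 0%N; exact: filt0|exact: (order_le0f K n k)].
  have [g [[l Fg] gk gE]] := IH (ltnW dk).
  (* The correction vanishes in degrees below [d], so the agreement reached there is kept. *)
  have [g' [[l' Fg'] gk' gE']] := diffop_interp d (fun m => u 'X_[m] - g 'X_[m]).
  exists (g + g'); split.
  - exists (maxn l l'); rewrite -[g]scale1r; apply: filtD.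
      by apply: filtS Fg; exact: leq_maxl.
    by apply: filtS Fg'; exact: leq_maxr.
  - by apply: (@order_leD _ _ k g g') => //; exact: order_leW gk'.
  - move=> m; rewrite ltnS diffopD => md; rewrite gE' //; case: eqP => [_|md'].
      by rewrite addrC subrK.
    by rewrite addr0 gE //; lia.
have [g [[l Fg] gk gE]] := approx _ (leqnn k.+1).
exists l; suff -> : u = g by [].
have ug0 : (u : P -> P) - g = 0.
  apply: (@order_le_eq0 k) => [a r s||m mk].
  - rewrite [LHS]/(u (a *: r + s) - g (a *: r + s)) !diffop_linear.
    rewrite [RHS]/(a *: (u r - g r) + (u s - g s)) [in RHS]scalerBr.
    have E (x y z t : P) : x + y - (z + t) = (x - z) + (y - t).
      by rewrite opprD addrACA.
    exact: E.
  - rewrite -[- _]scaleN1r; apply: order_leD => //; exact: order_leZ.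
  - rewrite [LHS]/(u 'X_[m] - g 'X_[m]) gE //; exact: subrr.
apply/val_inj/funext => r; apply/eqP; rewrite -subr_eq0.
by rewrite -[_ - _]/(((u : P -> P) - g) r) ug0.
Qed.

End Exhaustion.

(** * Families independent modulo a left ideal *)

Section Bernstein.
Context (K : fieldType) (p : nat) (charK : p \in [pchar K]) (n : nat).
Local Notation D := (diffop K n).
Local Notation F := (@canonical_filtration K n).
Local Notation xd := (mul_divpow K).

Lemma ltmc_add2l (m m1 m2 : 'X_{1..n}) :
  ((m1 + m)%MM < (m2 + m)%MM)%O = (m1 < m2)%O.
Proof. by rewrite !ltNge lemc_add2l. Qed.

Lemma ltmc_addU (m : 'X_{1..n}) i : (m < (U_(i) + m)%MM)%O.
Proof. by apply: lt_mdeg_ltmc; rewrite mdegD mdeg1. Qed.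

Let addmCA (a b c : 'X_{1..n}) : (a + (b + c) = b + (a + c))%MM.
Proof. by rewrite addmA [(a + b)%MM]addmC -addmA. Qed.

Variable I : set D.
Hypothesis I0 : I 0.
Hypothesis IM : forall u v w, I v -> I w -> I (u * v + w).

Let IZ c u : I u -> I (c *: u).
Proof. by move=> Iu; rewrite -[u]mul1r scalerAl -[_ * u]addr0; exact: IM. Qed.

Let ID u v : I u -> I v -> I (u + v).
Proof. by move=> Iu Iv; rewrite -[u]mul1r; exact: IM. Qed.

(** Induction on [a]. A variable moved left across [xd 0 ga] leaves two terms. In the first,
    [al + a] has dropped while [ga + b] has not, so it falls under the case of membership in [I]. In
    the second, the variable disappears from both [ga] and [a], which preserves the comparison. *)
Lemma divpow_lead k (al b a ga : 'X_{1..n}) :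
  (forall i, b i < p ^ k)%N -> (forall i, ga i < p ^ k)%N ->
  (forall be : 'X_{1..n}, (forall i, be i < p ^ k)%N -> (al < be)%O ->
     I (xd 0 be)) ->
  (((al + a)%MM < (ga + b)%MM)%O -> I (xd 0 ga * xd a b)) /\
  ((ga + b)%MM = (al + a)%MM ->
     I (xd 0 ga * xd a b -
        (\prod_(i < n) 'C(al i, b i))%N%:R *: xd 0 al)).
Proof.
move=> bq gq Imax; elim/mnm_ind: a ga gq => [|i a IH] ga gq.
  rewrite addm0 mul_divpow_d; split=> [lt_al|E]; last first.
    rewrite E; rewrite [X in _ *: X - _]/(xd 0 al).
    rewrite [X in X%:R *: _ - _](eq_bigr (fun i => 'C(al i, b i))) => [|i _].
      by rewrite subrr.
    by rewrite -E mnmDE.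
  (* If an entry of [ga + b] reaches [p^k], the carry kills the coefficient; otherwise [Imax]
     applies to [ga + b]. *)
  have [/existsP[i qi]|] := boolP [exists i, p ^ k <= ga i + b i]%N.
    rewrite (bigD1 i) //= natrM (bin_carry charK (bq i) (gq i) qi).
    by rewrite mul0r scale0r.
  rewrite negb_exists => /forallP qi; apply/IZ/Imax => // i.
  by rewrite mnmDE ltnNge.
have dxE : xd 0 ga * xd (U_(i) + a) b = xd U_(i) 0 * (xd 0 ga * xd a b) +
    (if ga i == 0%N then 0 else xd 0 (ga - U_(i)) * xd a b) :> D.
  rewrite -mul_divpow_x mulrA mul_divpow_dx mulrDl.
  have -> : xd U_(i) ga = xd U_(i) 0 * xd 0 ga by rewrite mul_divpow_x addm0.
  rewrite -mulrA; congr (_ + _).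
  by case: ifP; rewrite ?mul0r.
have lt_a : ((al + a)%MM < (al + (U_(i) + a))%MM)%O.
  by rewrite addmCA ltmc_addU.
have gaE : ga i != 0%N -> ga = (U_(i) + (ga - U_(i)))%MM.
  move=> gi; apply/mnmP => j; rewrite mnmDE mnmBE mnm1E.
  by case: eqVneq => [<-|_] /=; lia.
have gq' j : ((ga - U_(i))%MM j < p ^ k)%N.
  by rewrite mnmBE; apply: leq_ltn_trans (gq j); exact: leq_subr.
rewrite dxE; split=> [lt_al|E].
  apply: IM; first by apply: (IH ga gq).1; exact: lt_trans lt_al.
  have [//|gi] := eqVneq (ga i) 0%N; apply: (IH _ gq').1.
  by move: lt_al; rewrite {1}(gaE gi) addmCA -addmA ![(U_(i) + (_ + _))%MM]addmC ltmc_add2l.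
rewrite -addrA; apply: IM; first by apply: (IH ga gq).1; rewrite E.
have [gi|gi] := eqVneq (ga i) 0%N; last first.
  apply: (IH _ gq').2; apply: (@addmI _ U_(i)%MM).
  by rewrite addmA -(gaE gi) E addmCA.
(* The second term is missing, but [E] forces [b i = al i + a i + 1], so the expected coefficient is
   zero as well. *)
have lt_b : (al i < b i)%N.
  have := congr1 (fun m : 'X_{1..n} => m i) E.
  by rewrite !mnmDE mnm1E eqxx gi; lia.
by rewrite (bigD1 i) //= bin_small // mul0n scale0r subr0.
Qed.

(** A triangularity argument. In a relation modulo [I], left multiplication by [xd 0 (ga t0)], with
    [ga t0] largest among the nonzero coefficients, sends all other terms into [I] and turns the
    term of [t0] into a nonzero multiple of [xd 0 al], where [al = mn f]. This contradicts the
    choice of [f]. *)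
Theorem bernstein_family (T : finType) (tau : T -> 'X_{1..n}) i :
  ~ I 1 -> injective tau -> (forall t, mdeg (tau t) <= i)%N ->
  exists u : T -> D, (forall t, F i (u t)) /\
    forall c : T -> K, I (\sum_t c t *: u t) -> forall t, c t = 0.
Proof.
(* As [i < p^i], this [q] exceeds every entry of every [tau t]. *)
move=> I1 tau_inj tau_le; pose q := (p ^ i)%N.
have p_gt1 : (1 < p)%N by rewrite prime_gt1 // (pcharf_prime charK).
have tau_lt t j : (tau t j < q)%N.
  apply: leq_ltn_trans (ltn_expl i p_gt1); apply: leq_trans (tau_le t).
  by rewrite mdegE (bigD1 j) //= leq_addr.
have q_gt0 : (0 < q)%N by rewrite expn_gt0 ltnW.
(* Multi-indices with entries below [q] are encoded by a finite type, so that a largest one exists.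
   The search starts at [f0], which encodes 0, because 1 is not in [I]. *)
pose mn (f : {ffun 'I_n -> 'I_q}) : 'X_{1..n} := [multinom nat_of_ord (f i) | i < n].
have mn_lt f j : (mn f j < q)%N by rewrite mnmE.
pose f0 : {ffun 'I_n -> 'I_q} := [ffun=> Ordinal q_gt0].
have Pf0 : `[< ~ I (xd 0 (mn f0)) >].
  apply/asboolP; suff -> : mn f0 = 0%MM by rewrite mul_divpow00.
  by apply/mnmP => j; rewrite mnmE ffunE mnm0E.
pose f := [arg max_(f > f0 | `[< ~ I (xd 0 (mn f)) >]) (mn f)]%O.
have [/asboolP If fmax] : `[< ~ I (xd 0 (mn f)) >] /\
    forall g, `[< ~ I (xd 0 (mn g)) >] -> (mn g <= mn f)%O.
  by rewrite /f; case: arg_maxP => // g ? gmax; split.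
have Imax (be : 'X_{1..n}) : (forall j, be j < q)%N -> (mn f < be)%O ->
    I (xd 0 be).
  move=> be_lt lt_be; apply: contrapT => Ibe.
  pose g : {ffun 'I_n -> 'I_q} := [ffun j => Ordinal (be_lt j)].
  have gE : mn g = be by apply/mnmP => j; rewrite mnmE ffunE.
  have := fmax g; rewrite gE => /(_ (introT (asboolP _) Ibe)).
  by rewrite leNgt lt_be.
have /choice[G /choice[A /choice[B W]]] j := bin_neq0_shift charK (mn_lt f j).
pose ga t : 'X_{1..n} := [multinom G j (tau t j) | j < n].
pose a t : 'X_{1..n} := [multinom A j (tau t j) | j < n].
pose b t : 'X_{1..n} := [multinom B j (tau t j) | j < n].
have gaP t j : (ga t j < q)%N by rewrite mnmE; have [] := (W j).2 _ (tau_lt t j).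
have bP t j : (b t j < q)%N.
  rewrite mnmE; have [_ _ le_t _] := (W j).2 _ (tau_lt t j).
  by apply: leq_ltn_trans (tau_lt t j); apply: leq_trans le_t; exact: leq_addl.
have gabE t : (ga t + b t = mn f + a t)%MM.
  by apply/mnmP => j; rewrite !mnmDE ![[multinom _ | _ < _] _]mnmE;
    have [_ -> _ _] := (W j).2 _ (tau_lt t j); rewrite mnmE.
have ga_inj : injective ga.
  move=> t t' E; apply/tau_inj/mnmP => j; apply: (W j).1 => //.
  + by rewrite inE.
  + by rewrite inE.
  by have := congr1 (fun m : 'X_{1..n} => m j) E; rewrite !mnmE.
exists (fun t => xd (a t) (b t)); split=> [t|c Ic].
  apply/filt_xd/(leq_trans _ (tau_le t)); rewrite !mdegE -big_split /=.
  by apply: leq_sum => j _; rewrite !mnmE; have [] := (W j).2 _ (tau_lt t j).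
move=> t1; apply: contrapT => /eqP ct.
have [t0 ct0 t0max] : exists2 t, c t != 0 &
    forall u, c u != 0 -> (ga u <= ga t)%O.
  by case: (@arg_maxP _ _ _ t1 (fun t => c t != 0) ga ct) => t0 ? t0max; exists t0.
have [_ lead0] := divpow_lead (a t0) (bP t0) (gaP t0) Imax.
have Iterm t : t != t0 -> I (c t *: (xd 0 (ga t0) * xd (a t) (b t))).
  move=> tt0; have [->|ct'] := eqVneq (c t) 0; first by rewrite scale0r.
  (* Adding [b t] to [ga t < ga t0] gives [al + a t < ga t0 + b t]. *)
  apply/IZ/(divpow_lead (a t) (bP t) (gaP t0) Imax).1.
  rewrite -gabE ltmc_add2l lt_neqAle t0max // andbT.
  by apply: contra tt0 => /eqP/ga_inj ->.
have : I (c t0 *: (xd 0 (ga t0) * xd (a t0) (b t0))).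
  have -> : c t0 *: (xd 0 (ga t0) * xd (a t0) (b t0)) =
      xd 0 (ga t0) * (\sum_t c t *: xd (a t) (b t)) +
      (- 1 : K) *: \sum_(t | t != t0) c t *: (xd 0 (ga t0) * xd (a t) (b t)).
    rewrite mulr_sumr (bigD1 t0) //= scaleN1r -scalerAr.
    rewrite -[RHS]addrA -[X in X - _](eq_bigr _ (fun _ _ => scalerAr _ _ _)).
    by rewrite subrr addr0.
  apply: IM => //; apply: IZ; elim/big_rec: _ => // t u tt0 Iu.
  by apply: ID => //; exact: Iterm.
have C0 : c t0 * (\prod_(j < n) 'C(mn f j, b t0 j))%N%:R != 0.
  rewrite mulf_neq0 // natr_prod prodf_seq_neq0; apply/allP => j _.
  by rewrite [b t0 j]mnmE; have [] := (W j).2 _ (tau_lt t0 j).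
move=> /(IZ (-1)) Ic0; have := IZ (c t0) (lead0 (gabE t0)).
rewrite scalerBr scalerA => /ID /(_ Ic0); rewrite scaleN1r addrAC subrr add0r.
rewrite -scaleNr => /(IZ (- (c t0 * (\prod_(j < n) 'C(mn f j, b t0 j))%N%:R)^-1)).
by rewrite scalerA mulrNN mulVf // scale1r.
Qed.
End Bernstein.

(** * Dimensions of spans *)

Section Dimension.
Context (K : fieldType) (V : lmodType K).

(** The coordinates of [t] in a spanning family of size [d] form a matrix with independent rows. *)
Lemma card_indep_le (S : set V) d (T : finType) (t : T -> V) :
  has_dim S d -> (forall i, S (t i)) ->
  (forall c : T -> K, \sum_i c i *: t i = 0 -> forall i, c i = 0) ->
  (#|T| <= d)%N.
Proof.
move=> [s [_ Ss]] St t_free.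
have /choice[a aE] i : exists c : 'I_d -> K, t i = \sum_(j < d) c j *: s j.
  by apply/kspan_range; rewrite -Ss.
pose A := \matrix_(i < #|T|, j < d) a (enum_val i) j.
suff /eqP <- : row_free A by exact: rank_leq_col.
apply: inj_row_free => v vA; apply/rowP => i; rewrite mxE.
have -> : v 0 i = v 0 (enum_rank (enum_val i)) by rewrite enum_valK.
apply: (t_free (fun x => v 0 (enum_rank x))).
rewrite (reindex (@enum_val T predT)) /=; last exact/onW_bij/enum_val_bij.
under eq_bigr do rewrite aE enum_valK scaler_sumr.
rewrite exchange_big big1 //= => j _.
have := congr1 (fun r : 'rV_d => r 0 j) vA; rewrite !mxE => vA0.
rewrite -[RHS](scale0r (s j)) -vA0 scaler_suml; apply: eq_bigr => k _.
by rewrite mxE scalerA.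
Qed.

(** A dependent family loses a vector without changing its span. Existence matters because [kdim] is
    0 by default when there is no dimension. *)
Lemma has_dim_kspan m (s : 'I_m -> V) : exists d, has_dim (kspan (range s)) d.
Proof.
elim: m s => [|m IH] s; first by exists 0%N, s; split=> // c _ [].
have [s_free|] := pselect (lin_indep s); first by exists m.+1, s.
move=> /existsNP[c] /not_implyP[c0] /existsNP[i /eqP ci].
have [d dP] := IH (s \o lift i); exists d.
rewrite (_ : kspan _ = kspan (range (s \o lift i))) //.
have [k0 kD] := kspan_submod (range (s \o lift i)).
apply/seteqP; split; last by apply: kspanS => _ [j _ <-]; exists (lift i j).
apply: kspan_min => // _ [j _ <-].
case: (unliftP i j) => [k ->|->]; first by apply: sub_kspan; exists k.
have -> : s i = (- (c i)^-1) *: \sum_k c (lift i k) *: s (lift i k).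
  rewrite (bigD1_ord i) //= in c0; apply: (scalerI ci); rewrite scalerA mulrN mulfV //.
  by rewrite scaleN1r; apply/eqP; rewrite -addr_eq0 c0.
rewrite -[X in _ X]addr0; apply: kD => //.
by apply/kspan_range; exists (fun k => c (lift i k)).
Qed.

Lemma has_dim_kspan_fin (T : finType) (s : T -> V) :
  exists d, has_dim (kspan (range s)) d.
Proof.
have [d dP] := has_dim_kspan (fun i : 'I_#|T| => s (enum_val i)); exists d.
rewrite (_ : range s = range (fun i : 'I_#|T| => s (enum_val i))) //.
apply/seteqP; split=> _ [x _ <-]; last by exists (enum_val x).
by exists (enum_rank x) => //; rewrite enum_rankK.
Qed.
End Dimension.

(** * Modules and chains of submodules *)

Section Modules.
Context (K : fieldType) (n : nat) (M : lmodType (diffop K n)).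
Local Notation D := (diffop K n).
Local Notation F := (@canonical_filtration K n).
Local Notation xd := (mul_divpow K).
Local Notation MK := (restrict_scalars M).

Lemma scaleKE (c : K) (m : MK) : c *: m = (c%:A : D) *: (m : M).
Proof. by []. Qed.

Lemma scaleK_diffop (c : K) (u : D) (m : M) :
  ((c *: u) *: m : M) = (c *: (u *: m : MK) : MK).
Proof. by rewrite scaleKE scalerA mulr_algl. Qed.

Lemma diffop_scaleK (c : K) (u : D) (m : MK) :
  (u *: (c *: m : MK) : M) = (c *: (u *: (m : M) : MK) : MK).
Proof. by rewrite scaleKE scalerA mulr_algr -scaleK_diffop. Qed.

Lemma actS (A B : set D) (M0 : set MK) : A `<=` B -> act A M0 `<=` act B M0.
Proof.
move=> AB; apply: kspanS => _ [u Au [m mM <-]].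
by exists u; [exact: AB|exists m].
Qed.

(** The finitely many [xd a b] of degree at most [i], applied to a basis of [M0], span this space;
    so [hilbert_fun] is a true dimension. *)
Lemma has_dim_act_filt (M0 : set MK) i : fin_dim_subspace M0 ->
  exists d, has_dim (act (F i) M0) d.
Proof.
move=> [m [s [_ ->]]].
pose T := ('X_{1..n < i.+1} * 'X_{1..n < i.+1} * 'I_m)%type.
pose ok (t : T) := (mdeg t.1.1 + mdeg t.1.2 <= i)%N.
pose g (t : {t : T | ok t}) : MK := xd (val t).1.1 (val t).1.2 *: (s (val t).2 : M).
have [d gd] := has_dim_kspan_fin g; exists d.
rewrite (_ : act _ _ = kspan (range g)) //; apply/seteqP; split; last first.
  apply: kspanS => _ [[t tok] _ <-]; rewrite /g /=.
  exists (xd t.1.1 t.1.2); first exact: filt_xd.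
  by exists (s t.2) => //; apply: sub_kspan; exists t.2.
have [k0 kD] := kspan_submod (range g).
apply: kspan_min => // _ [u Fu [v Mv <-]]; move: u Fu.
apply: filt_min => [|c u w Iu Iw|a b ab].
- by rewrite scale0r.
- by rewrite scalerDl scaleK_diffop; exact: kD.
move: v Mv.
apply: (@kspan_ind K MK) => [|c u w Iu Iw|_ [j _ <-]].
- by rewrite scaler0.
- by rewrite scalerDr diffop_scaleK; exact: kD.
 apply: sub_kspan.
have ai : (mdeg a < i.+1)%N by lia.
have bi : (mdeg b < i.+1)%N by lia.
by exists (exist _ (BMultinom ai, BMultinom bi, j) ab).
Qed.

Lemma act_filtM i k (M0 : set MK) (u : D) (v : M) : F i u -> act (F k) M0 v ->
  act (F (i + k)) M0 (u *: v).
Proof.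
move=> Fu; move: v.
have [k0 kD] := kspan_submod [set (w *: (m : M) : MK) | w in F (i + k) & m in M0].
apply: (@kspan_ind K MK) => [|c v w Iv Iw|_ [w Fw [m Mm <-]]].
- by rewrite scaler0.
- by rewrite scalerDr diffop_scaleK; exact: kD.
 apply: sub_kspan.
by exists (u * w); [exact: filtM|exists m => //; rewrite scalerA].
Qed.

Lemma act_exhaustive (M0 : set MK) (v : M) : generates M0 ->
  exists k, act (F k) M0 v.
Proof.
move=> gM; have : act setT M0 v by rewrite gM.
move: v; apply: (@kspan_ind K MK) => [|c u v [k ku] [l lv]|_ [u _ [m Mm <-]]].
- by exists 0%N; have [] := kspan_submod [set (w *: (m : M) : MK) | w in F 0 & m in M0].
- exists (maxn k l).
  have [_] := kspan_submod [set (w *: (m : M) : MK) | w in F (maxn k l) & m in M0].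
  apply; [apply: actS ku|apply: actS lv]; apply: filtS.
    exact: leq_maxl.
  exact: leq_maxr.
have [k Fu] := filt_exhaustive u.
by exists k; apply: sub_kspan; exists u => //; exists m.
Qed.

Definition submodule_chain d (N : nat -> set M) : Prop :=
  [/\ N 0%N = [set 0], N d = setT,
      forall i, (i <= d)%N -> is_submodule (N i) &
      forall i, (i < d)%N -> N i `<=` N i.+1 /\ N i <> N i.+1].

Lemma submodule_chain_le d N i j : submodule_chain d N ->
  (i <= j <= d)%N -> N i `<=` N j.
Proof.
move=> [_ _ _ Nlt] /andP[/subnKC <-]; elim: (j - i)%N => [|l IH].
  by rewrite addn0 => _ x.
by rewrite addnS => ld; apply: subset_trans (IH (ltnW ld)) (Nlt _ ld).1.
Qed.

(** A submodule [L] strictly between consecutive terms could be inserted, giving a chain of length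
    [d + 1]. *)
Lemma maximal_chain_has_length d N : submodule_chain d N ->
  (forall e N', submodule_chain e N' -> (e <= d)%N) -> has_length M d.
Proof.
move=> [N0 Nd Nsub Nlt] dmax; exists N; split=> // i lt_id.
have [iS iN] := Nlt i lt_id; split=> // L Lsub iL Li.
have [|/not_orP[LN LN']] := pselect (L = N i \/ L = N i.+1) => //.
pose N' j := if (j <= i)%N then N j else if j == i.+1 then L else N j.-1.
suff /dmax : submodule_chain d.+1 N' by rewrite ltnn.
split; rewrite /N'.
- by rewrite leq0n.
- have -> : (d < i)%N = false by apply/negbTE; rewrite -leqNgt ltnW.
  by case: eqP => [[di]|//]; rewrite di ltnn in lt_id.
- move=> j jd; case: leqP => [ji|ij]; first by apply: Nsub; lia.
  by case: eqP => // _; apply: Nsub; lia.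
move=> j jd; have [ji|ij|->] := ltngtP j i; last first.
- by rewrite eqxx; split=> // E; apply: LN.
- case: eqVneq => [ji|ji].
    by rewrite ji gtn_eqF //=; split=> // E; apply: LN'.
  rewrite gtn_eqF /=; last by lia.
  by have := Nlt j.-1; rewrite prednK; [apply; lia|lia].
- exact: Nlt (ltn_trans ji lt_id).
Qed.

Lemma exists_has_length B : (exists m : M, m != 0) ->
  (forall d N, submodule_chain d N -> (d <= B)%N) ->
  exists d, has_length M d /\ exists N, submodule_chain d N.
Proof.
move=> [m m0] Bmax; pose Q d := `[< exists N, submodule_chain d N >].
have exQ : exists d, Q d.
  (* Since [M] is nonzero, 0 and [M] form a chain of length 1. *)
  exists 1%N; apply/asboolP; exists (fun i => if i is 0%N then [set 0] else setT).
  split=> // [[|i] _|[|//] _].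
  - split=> // u v w /= -> ->; by rewrite scaler0 addr0.
  - by split.
  - split=> // E; move/eqP: m0; apply.
    by have : [set: M] m by []; rewrite -E.
have Qmax d : Q d -> (d <= B)%N by move=> /asboolP[N /Bmax].
case: (ex_maxnP exQ Qmax) => d /asboolP[N Nd] dmax.
exists d; split; last by exists N.
by apply: (maximal_chain_has_length Nd) => e N' N'e; apply/dmax/asboolP; exists N'.
Qed.

(** For [v j] in [N j.+1] but not in [N j], the operators sending [v j] into [N j] form a proper
    left ideal. The families independent modulo these ideals, applied to the [v j], are jointly
    independent. *)
Lemma chain_hilbert_fun (p : nat) (charK : p \in [pchar K]) (M0 : set MK) d N :
  fin_dim_subspace M0 -> generates M0 -> submodule_chain d N ->
  exists2 k, (0 < k)%N & forall i, (d * 'C(n + i, n) <= hilbert_fun M0 (i + k))%N.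
Proof.
move=> fM gM Nd; have [_ _ Nsub Nlt] := Nd.
have /choice[v vN] (j : 'I_d) : exists v, N j.+1 v /\ ~ N j v.
  apply: contrapT => noV; have [jS jN] := Nlt j (ltn_ord j); apply: jN.
  apply/seteqP; split=> // w Nw; apply: contrapT => Nw'; apply: noV.
  by exists w.
have /choice[kk kkP] (j : 'I_d) := act_exhaustive (v j) gM.
(* Every [v j] occurs by step [k] of the filtration; the successor makes the shift positive. *)
pose k := (\max_j kk j)%N; exists k.+1 => // i.
have [e dime] := has_dim_act_filt (i + k.+1) fM.
rewrite /hilbert_fun (kdimE dime).
(* These are the exponents of total degree at most [i]; bounding each entry by [i] makes the type
   finite. *)
pose T := {t : n.-tuple 'I_i.+1 | (\sum_(j <- t) j <= i)%N}.
have cardT : #|{: T}| = 'C(n + i, n)%N.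
  by rewrite card_sig -card_partial_ord_partitions cardsE.
pose tau (t : T) : 'X_{1..n} := [multinom nat_of_ord (tnth (val t) j) | j < n].
have tau_inj : injective tau.
  move=> t t' E; apply/val_inj/eq_from_tnth => j; apply/val_inj.
  by have := congr1 (fun m : 'X_{1..n} => m j) E; rewrite !mnmE.
have tau_le t : (mdeg (tau t) <= i)%N.
  have := valP t; rewrite big_tuple mdegE.
  by under [X in _ -> (X <= _)%N]eq_bigr do rewrite mnmE.
have /choice[u uP] (j : 'I_d) : exists u : T -> D, (forall t, F i (u t)) /\
    forall c : T -> K, N j ((\sum_t c t *: u t) *: v j) -> forall t, c t = 0.
  have [N0 ND] := Nsub j (ltnW (ltn_ord j)).
  apply: (@bernstein_family K p charK n [set w : D | N j (w *: v j)]) => //=.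
  - by rewrite scale0r.
  - by move=> x y z Iy Iz; rewrite scalerDl -scalerA; exact: ND.
  - by rewrite scale1r; have [] := vN j.
  - exact: tau_inj.
rewrite -cardT -[d in (d * _)%N]card_ord -card_prod.
apply: (card_indep_le (t := fun x : 'I_d * T => (u x.1 x.2 *: v x.1 : MK)) dime).
  move=> [j t] /=; apply: act_filtM; first by have [] := uP j.
  apply: actS (kkP j); apply/filtS/leqW; exact: (leq_bigmax j).
move=> c c0 [j1 t1]; apply: contrapT => /eqP cjt.
pose Q (j : 'I_d) := [exists t, c (j, t) != 0].
have Qj1 : Q j1 by apply/existsP; exists t1.
(* Take the largest [j] with a nonzero coefficient. Terms of larger index vanish, and those of
   smaller index lie in [N j], so a relation modulo [N j] remains. *)
case: (arg_maxnP (fun j : 'I_d => nat_of_ord j) Qj1) => j /existsP[t /eqP ct] jmax.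
apply: ct; apply: ((uP j).2 (fun t => c (j, t))).
have [N0 ND] := Nsub j (ltnW (ltn_ord j)).
have NN x : N j x -> N j (- x).
  by move=> Nx; rewrite -scaleN1r -[_ *: _]addr0; exact: ND.
have NZ (a : K) (x : M) : N j x -> N j (a *: (x : MK) : MK).
  by move=> Nx; rewrite scaleKE -[_ *: _]addr0; exact: ND.
have Nsum I (r : seq I) (P : pred I) (x : I -> M) :
    (forall i, P i -> N j (x i)) -> N j (\sum_(i <- r | P i) x i).
  move=> Nx; elim/big_rec: _ => // l y Pl Ny; rewrite -[x l]scale1r.
  by apply: ND => //; exact: Nx.
have sumE : \sum_(l : 'I_d) (\sum_t c (l, t) *: u l t) *: v l = 0 :> M.
  rewrite -[RHS]c0 [RHS](eq_bigr (fun x : 'I_d * T =>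
    (c (x.1, x.2) *: u x.1 x.2) *: v x.1 : M)) => [|[a b] _]; last first.
    by rewrite scaleK_diffop.
  rewrite -(pair_bigA _ (fun a b => (c (a, b) *: u a b) *: v a)) /=.
  by apply: eq_bigr => l _; rewrite scaler_suml.
rewrite (bigD1 j) //= in sumE; move/eqP: sumE; rewrite addr_eq0 => /eqP ->.
apply/NN/Nsum => l lj; have [jl|lt_lj] := leqP j l.
  rewrite big1 ?scale0r // => t' _.
  suff -> : c (l, t') = 0 by rewrite scale0r.
  apply: contrapT => /eqP clt; have /jmax /= lj' : Q l by apply/existsP; exists t'.
  by move: lj; rewrite -val_eqE /= eqn_leq jl lj'.
rewrite -[_ *: _]addr0; apply: ND => //.
apply: (@submodule_chain_le d N l.+1 j Nd); last by have [] := vN l.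
by rewrite lt_lj ltnW.
Qed.
End Modules.

(** * Inequalities comparing growth rates *)

(** The right side is the product [(i + 1) ... (i + n)]. *)
Lemma expn_le_fact_bin n i : (i ^ n <= n`! * 'C(n + i, n))%N.
Proof.
rewrite mulnC bin_ffact; elim: n => [|n IH]; first by rewrite ffactn0.
by rewrite addSn ffactSS expnS leq_mul // ltnW // ltnS leq_addl.
Qed.

Lemma bernoulli_le (F : realDomainType) (x : F) n :
  0 <= x <= 1 -> 1 - x *+ n <= (1 - x) ^+ n.
Proof.
case/andP=> x0 x1; elim: n => [|n IH]; first by rewrite mulr0n subr0.
have x1' : 0 <= 1 - x by rewrite subr_ge0.
rewrite exprS; apply: le_trans (ler_wpM2l x1' IH).
have := mulr_ge0 x0 (mulrn_wge0 n x0).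
by rewrite mulrSr; move: (x *+ n) => y xy; rewrite mulrBl !mulrBr; lra.
Qed.

Lemma horner_le_expr (F : realFieldType) (q : {poly F}) n x :
  (size q <= n.+1)%N -> 1 <= x -> q.[x] <= (\sum_(i < n.+1) `|q`_i|) * x ^+ n.
Proof.
move=> qn x1; rewrite (horner_coef_wide _ qn) mulr_suml; apply: ler_sum => i _.
apply: (@le_trans _ _ (`|q`_i| * x ^+ i)).
  by rewrite ler_wpM2r ?ler_norm // exprn_ge0 // (le_trans ler01).
by rewrite ler_wpM2l // ler_weXn2l // -ltnS.
Qed.

(* Testing at i = k m gives d (m / (m + 1))^n <= c, and the left side is at
   least d (1 - n / (m + 1)). *)
Lemma le_of_shifted_expr (R : archiRealFieldType) (d : nat) (l : R) n k :
  (0 < k)%N -> (forall c, l < c -> exists i0, forall i, (i0 <= i)%N ->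
     d%:R * i%:R ^+ n <= c * (i + k)%:R ^+ n) -> d%:R <= l.
Proof.
move=> k0 dl; rewrite leNgt; apply/negP => lt_ld.
pose c := (l + d%:R) / 2.
have lc : l < c by rewrite /c; lra.
have cd : c < d%:R by rewrite /c; lra.
have [i0 i0P] := dl _ lc.
(* This [m] exceeds [i0] or equals it, and satisfies [d n < (m + 1) (d - c)], which contradicts
   [d (1 - n / (m + 1)) <= c]. *)
pose m := (maxn i0 (Num.bound (d%:R *+ n / (d%:R - c))))%N.
have m1 : 0 < m.+1%:R :> R by rewrite ltr0n.
have k1 : 0 < k%:R :> R by rewrite ltr0n.
have i0m : (i0 <= k * m)%N.
  by apply: (@leq_trans m); [exact: leq_maxl|exact: leq_pmull].
have := i0P _ i0m; rewrite -[X in (_ + X)%:R]muln1 -mulnDr addn1.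
rewrite !natrM !exprMn.
rewrite mulrCA [leRHS]mulrCA ler_pM2l ?exprn_gt0 // => le_c.
have le_c' : d%:R * (1 - m.+1%:R^-1) ^+ n <= c.
  have -> : 1 - m.+1%:R^-1 = m%:R / m.+1%:R :> R.
    apply: (mulIf (lt0r_neq0 m1)).
    by rewrite divfK ?lt0r_neq0 // mulrBl mul1r mulVf ?lt0r_neq0 // -natr1 addrK.
  by rewrite expr_div_n mulrA ler_pdivrMr ?exprn_gt0.
have := le_trans (ler_wpM2l (ler0n R d) (@bernoulli_le _ m.+1%:R^-1 n _)) le_c'.
rewrite invr_ge0 ltW //= invf_le1 // ler1n => /(_ isT).
rewrite mulrBr mulr1 lerBlDl -lerBlDr mulrnAr -mulrnAl ler_pdivlMr //.
rewrite leNgt mulrC -ltr_pdivrMr ?subr_gt0 //; case/negP.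
apply: (@lt_trans _ _ m%:R); last by rewrite ltr_nat.
apply: lt_le_trans (archi_boundP _) _.
  by rewrite divr_ge0 ?mulrn_wge0 // subr_ge0 ltW.
by rewrite ler_nat leq_maxr.
Qed.

(** * Bounds on the length of chains *)

Lemma chain_expn (K : fieldType) (p : nat) (charK : p \in [pchar K]) (n : nat)
    (M : lmodType (diffop K n)) (M0 : set (restrict_scalars M)) d
    (N : nat -> set M) :
  fin_dim_subspace M0 -> generates M0 -> submodule_chain d N ->
  exists2 k, (0 < k)%N &
    forall i, (d * i ^ n <= n`! * hilbert_fun M0 (i + k))%N.
Proof.
move=> fM gM Nd; have [k k0 kP] := chain_hilbert_fun charK fM gM Nd.
exists k => // i; apply: leq_trans (leq_mul (leqnn _) (kP i)).
by rewrite mulnCA leq_mul // expn_le_fact_bin.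
Qed.

(** The bound must be uniform although the shift [k] depends on the chain. For [i >= k] one has
    [(i + k)^n <= 2^n i^n], so [i^n] cancels and [d <= n! 2^n C] remains. *)
Lemma holonomic_chain_bounded (K : fieldType) (p : nat)
    (charK : p \in [pchar K]) (n : nat) (M : lmodType (diffop K n)) :
  holonomic M -> exists B, forall d (N : nat -> set M),
    submodule_chain d N -> (d <= B)%N.
Proof.
move=> [_ [M0 [fM gM [q [sq [i0 _ i0P]]]]]].
pose C : rat := \sum_(i < n.+1) `|q`_i|.
have C0 : 0 <= C by apply: sumr_ge0.
exists (Num.bound ((n`! * 2 ^ n)%:R * C)) => d N Nd.
have [k k0 kP] := chain_expn charK fM gM Nd.
pose i := maxn i0 k; have i_gt0 : (0 < i)%N by rewrite leq_max k0 orbT.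
have hC : (hilbert_fun M0 (i + k))%:R <= C * (i + k)%:R ^+ n.
  apply: le_trans (i0P (i + k)%N _) _.
    by rewrite /= -[i0]addn0 leq_add // leq_maxl.
  by apply: horner_le_expr; [rewrite sq|rewrite ler1n addn_gt0 i_gt0].
rewrite -(ler_nat rat); apply/ltW/le_lt_trans/archi_boundP; last first.
  by rewrite mulr_ge0.
have in_gt0 : 0 < i%:R ^+ n :> rat by rewrite exprn_gt0 // ltr0n.
rewrite -(ler_pM2r in_gt0) -natrX -natrM.
apply: (@le_trans _ _ (n`! * hilbert_fun M0 (i + k))%:R); first by rewrite ler_nat.
rewrite natrM natrM -!mulrA ler_wpM2l //; apply: le_trans hC _.
rewrite mulrCA ler_wpM2l // !natrX -exprMn -natrM lerXn2r ?nnegrE ?ler0n //.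
by rewrite ler_nat mul2n -addnn leq_add2l leq_maxr.
Qed.

End DiffOpLength.

(* Finite length and the multiplicity bound *)
From mathcomp Require Import normedtype landau.
Import numFieldNormedType.Exports DiffOpLength.

Theorem theorem9p6 (R : realType) (K : fieldType) (p : nat)
    (charK : p \in [pchar K]) (n : nat) (n_gt0 : (0 < n)%N)
    (M : lmodType (diffop K n)) (holM : holonomic M) :
  exists d : nat, has_length M d /\
    forall (M0 : set (restrict_scalars M)) (l : R),
      fin_dim_subspace M0 -> generates M0 ->
      (exists2 e : nat -> R, e =o_\oo (fun i : nat => i%:R ^+ n : R) &
         \forall i \near \oo, (hilbert_fun M0 i)%:R <= l * i%:R ^+ n + e i) ->
      d%:R <= (n`!)%:R * l.
Proof.
have [B NB] := holonomic_chain_bounded charK holM.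
have [d [Md [N Nd]]] := exists_has_length holM.1 NB.
exists d; split=> // M0 l fM gM [e eo [i1 _ i1P]].
have [k k0 kP] := chain_expn charK fM gM Nd.
have nf_gt0 : 0 < n`!%:R :> R by rewrite ltr0n fact_gt0.
apply: (le_of_shifted_expr (n := n) k0) => c lt_c.
(* With this choice [c = n! (l + eps)], and eventually the error term is at most [eps i^n]. *)
pose eps := c / n`!%:R - l.
have eps_gt0 : 0 < eps by rewrite subr_gt0 ltr_pdivlMr // mulrC.
have [i2 _ i2P] : \forall i \near \oo, `|e i| <= eps * `|i%:R ^+ n : R|.
  by move/eqoP: eo; apply.
exists (maxn i1 i2) => i; rewrite geq_max => /andP[i1i i2i].
rewrite -natrX -natrM; apply: (@le_trans _ _ (n`! * hilbert_fun M0 (i + k))%:R).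
  by rewrite ler_nat.
have -> : c = n`!%:R * (l + eps).
  by rewrite addrC subrK mulrC divfK // lt0r_neq0.
rewrite natrM -mulrA ler_pM2l //.
apply: le_trans (i1P (i + k)%N _) _; first exact: leq_trans (leq_addr _ _).
rewrite mulrDl lerD2l; apply: le_trans (ler_norm _) _.
have := i2P (i + k)%N (leq_trans i2i (leq_addr _ _)).
by rewrite [`|_ ^+ n|]ger0_norm // exprn_ge0.
Qed.
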